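(* Let $G$ be a finite simple graph (with nonempty vertex set) without isolated vertices. Then $G$ is in $W_2$ if and only if $G$ is well-covered and $\mathcal{F}_G=\mathcal{A}_G$.
   Context: A set $A$ of vertices of $G$ is stable if it contains no edge of $G$ (i.e. no two vertices of $A$ are adjacent); a maximum stable set is a stable set of largest cardinality. $G$ is well-covered if every maximal (with respect to inclusion) stable set is a maximum stable set. $G$ belongs to the class $W_2$ if $|V(G)|\geq 2$ and any $2$ disjoint stable sets are contained in $2$ disjoint maximum stable sets (each of the two stable sets being contained in one of the two disjoint maximum stable sets). A vertex cover is a set of vertices meeting every edge; it is minimal if it is minimal with respect to inclusion. For a stable set $A$, $N_G(A)$ is the set of all vertices $v$ such that $\{v\}\cup A$ contains an edge of $G$. $\mathcal{F}_G$ is the family of all maximal stable sets of $G$, and $\mathcal{A}_G$ is the family of all stable sets $A$ of $G$ such that $N_G(A)$ is a minimal vertex cover of $G$. *)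

(* Defs.v *)
(* A finite simple graph is a symmetric irreflexive relation e
   on a finType T of vertices. *)
From mathcomp Require Import all_boot.

Set Implicit Arguments.
Unset Strict Implicit.
Unset Printing Implicit Defensive.

Section Graph.
Variables (T : finType) (e : rel T).
Implicit Types A B C : {set T}.

Definition contains_edge A := [exists x in A, exists y in A, e x y].

Definition stable A := ~~ contains_edge A.

Definition maximal_stable A := maxset stable A.

Definition maximum_stable A :=
  stable A && [forall B : {set T}, stable B ==> (#|B| <= #|A|)].

Definition well_covered := forall A, maximal_stable A -> maximum_stable A.

Definition in_W2 :=
  2 <= #|T| /\
  (forall A B, stable A -> stable B -> [disjoint A & B] ->
     exists A' B', [/\ maximum_stable A', maximum_stable B',
                       [disjoint A' & B'], A \subset A' & B \subset B']).

Definition vertex_cover C :=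
  [forall x, forall y, e x y ==> (x \in C) || (y \in C)].

Definition minimal_vertex_cover C := minset vertex_cover C.

Definition neighbours A := [set v | contains_edge (v |: A)].

Definition family_F : {set {set T}} := [set A | maximal_stable A].

Definition family_A : {set {set T}} :=
  [set A | stable A && minimal_vertex_cover (neighbours A)].

End Graph.

(* Main.v *)
(** For a maximal stable set [M] the cover [~: M] is minimal, and every minimal
    cover has this form; so [family_F e = family_A e] says that no [A] strictly
    inside a maximal stable set [M] satisfies [N(A) = ~: M].  Applied to [M :\ x],
    this yields a vertex [y] outside [M] whose only neighbour in [M] is [x], and
    [y] can be exchanged for [x].  Given disjoint stable [A] and [B], exchanges
    turn a maximum stable set containing [A] into one that also avoids [B]; doing
    this twice separates [A] and [B].  Conversely, if [N(A)] is a cover and [x] is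
    a vertex outside [A] and [N(A)], then the only maximal stable set containing
    [A] is [~: N(A)], which contains [x], so [A] and [[set x]] cannot be separated. *)
Require Import Defs.
From mathcomp Require Import all_boot.

Section StableSets.
Context {T : finType} (e : rel T).
Implicit Types (x y : T) (A B C M : {set T}).

Lemma stableP A :
  reflect (forall x y, x \in A -> y \in A -> ~~ e x y) (stable e A).
Proof.
apply: (iffP idP) => [stA x y Ax Ay | stA].
  apply: contra stA => exy; apply/exists_inP; exists x => //.
  by apply/exists_inP; exists y.
apply/exists_inP => -[x Ax /exists_inP[y Ay exy]].
by move: (stA x y Ax Ay); rewrite exy.
Qed.

Lemma stable_sub {A B} : A \subset B -> stable e B -> stable e A.
Proof.
move=> /subsetP sAB /stableP stB; apply/stableP => x y /sAB Bx /sAB By.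
exact: stB.
Qed.

Lemma stable0 : stable e set0.
Proof. by apply/stableP => x y; rewrite inE. Qed.

Lemma stable1 x : irreflexive e -> stable e [set x].
Proof. by move=> e_irr; apply/stableP => y z /set1P-> /set1P->; rewrite e_irr. Qed.

Lemma mem_neighbours A x : (x \in neighbours e A) = ~~ stable e (x |: A).
Proof. by rewrite inE negbK. Qed.

Lemma vertex_coverE C : vertex_cover e C = stable e (~: C).
Proof.
apply/'forall_forallP/stableP => [covC x y | stC x y].
  rewrite !inE => Cx Cy; apply: contraTN (covC x y) => ->.
  by rewrite (negPf Cx) (negPf Cy).
apply/implyP => exy; apply: contraTT exy.
by rewrite negb_or => /andP[Cx Cy]; apply: stC; rewrite inE.
Qed.

(** Complementation reverses inclusion and exchanges covers with stable sets. *)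
Lemma minimal_vertex_coverE C :
  minimal_vertex_cover e C = maximal_stable e (~: C).
Proof.
rewrite /maximal_stable maxminset setCK.
by apply: minset_eq => D; rewrite vertex_coverE.
Qed.

Lemma maximum_stableP A :
  reflect (stable e A /\ forall B, stable e B -> #|B| <= #|A|)
          (maximum_stable e A).
Proof.
apply: (iffP andP) => -[stA maxA]; split=> //; first by move=> B; apply/implyP/(forallP maxA).
by apply/forallP => B; apply/implyP/maxA.
Qed.

Lemma maximum_maximal {A} : maximum_stable e A -> maximal_stable e A.
Proof.
case/maximum_stableP => stA maxA; apply/maxsetP; split=> // B stB sAB.
by apply/esym/eqP; rewrite eqEcard sAB maxA.
Qed.

(** Adding a member of [M] changes nothing, while adding an outsider destroys stability by
    maximality. *)
Lemma neighbours_maximal {M} : maximal_stable e M -> neighbours e M = ~: M.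
Proof.
move=> /maxsetP[stM maxM]; apply/setP => x; rewrite mem_neighbours inE.
have [Mx | nMx] := boolP (x \in M); first by rewrite (setUidPr _) ?sub1set ?stM.
by apply: contraNN nMx => /maxM <-; rewrite ?subsetUr ?setU11.
Qed.

Lemma family_F_sub : family_F e \subset family_A e.
Proof.
apply/subsetP => M; rewrite !inE => maxM.
by rewrite (maxsetp maxM) neighbours_maximal // minimal_vertex_coverE setCK.
Qed.

Lemma exchange {M x} : symmetric e -> irreflexive e ->
    family_F e = family_A e -> maximum_stable e M -> x \in M ->
  exists y, [/\ e x y, y \notin M & maximum_stable e (y |: M :\ x)].
Proof.
move=> e_sym e_irr eqFA maxM Mx; have [stM leM] := maximum_stableP _ maxM.
have mxM := maximum_maximal maxM.
have stMx : stable e (M :\ x) := stable_sub (subD1set M x) stM.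
(* [M :\ x] is stable but lies strictly inside the stable set [M], so it is not in [family_F e]. *)
have : M :\ x \notin family_A e.
  rewrite -eqFA inE; apply/negP => /maxsetP[_ /(_ M stM (subD1set M x)) eqM].
  by move: Mx; rewrite eqM !inE eqxx.
rewrite inE stMx /= => /negP notmin.
(* Neighbourhoods grow with the set, so [neighbours e (M :\ x)] lies inside [~: M]; equality would
   make it a minimal cover. Hence some [y] outside [M] is missed. *)
have /subsetPn[y nMy nNy] : ~~ (~: M \subset neighbours e (M :\ x)).
  apply/negP => sMN; apply: notmin.
  suff -> : neighbours e (M :\ x) = ~: M by rewrite minimal_vertex_coverE setCK.
  apply/eqP; rewrite eqEsubset sMN andbT -(neighbours_maximal mxM).
  apply/subsetP => y; rewrite !mem_neighbours; apply: contraNN.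
  by apply: stable_sub; rewrite setUS ?subD1set.
rewrite inE in nMy; rewrite mem_neighbours negbK in nNy.
have Ny : y \in neighbours e M by rewrite neighbours_maximal // inE.
exists y; split=> //; last first.
  apply/maximum_stableP; split=> // B /leM /leq_trans -> //.
  by rewrite cardsU1 in_setD1 (negPf nMy) andbF (cardsD1 x M) Mx.
(* If [y] were not adjacent to [x], then [y |: M] would be stable. *)
apply: contraLR Ny => nexy; rewrite mem_neighbours negbK.
move/stableP: nNy => stN; move/stableP: stM => stM.
apply/stableP => u v /setU1P[->|Mu] /setU1P[->|Mv].
- by rewrite e_irr.
- have [-> | nvx] := eqVneq v x; first by rewrite e_sym.
  by apply: stN; rewrite !inE ?eqxx // nvx Mv orbT.
- have [-> // | nux] := eqVneq u x.
  by apply: stN; rewrite !inE ?eqxx // nux Mu orbT.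
- exact: stM.
Qed.

Lemma extend_avoiding {A B} : symmetric e -> irreflexive e ->
    well_covered e -> family_F e = family_A e ->
    stable e A -> stable e B -> [disjoint A & B] ->
  exists M, [/\ maximum_stable e M, A \subset M & [disjoint M & B]].
Proof.
move=> e_sym e_irr wc eqFA stA /stableP stB dAB.
have [M0 mxM0 sAM0] := maxset_exists stA.
pose P := [pred M : {set T} | maximum_stable e M && (A \subset M)].
have PM0 : P M0 by rewrite /= sAM0 andbT; apply: wc.
(* Among the maximum stable sets containing [A], take one that meets [B] least. If it met [B] in
   [x], exchanging [x] would keep [A] and, since the new vertex is adjacent to [x] and so outside
   [B], shrink the intersection. *)
have [M /andP[maxM sAM] minM] := arg_minnP (fun M : {set T} => #|M :&: B|) PM0.
exists M; split=> //; rewrite -setI_eq0; apply/set0Pn => -[x /setIP[Mx Bx]].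
have [y [exy nMy maxM']] := exchange e_sym e_irr eqFA maxM Mx.
have nAx : x \notin A by rewrite (disjointFl dAB).
have nBy : y \notin B by apply: contraL exy => By; apply: stB.
have : #|M :&: B| <= #|(y |: M :\ x) :&: B|.
  apply: minM; rewrite /= maxM' /=; apply: subset_trans (subsetUr _ _).
  by rewrite subsetD1 sAM.
rewrite leqNgt => /negP[]; apply: proper_card; apply/properP; split.
  apply/subsetP => z /setIP[/setU1P[->|/setD1P[_ Mz]] Bz]; last by rewrite inE Mz.
  by rewrite Bz in nBy.
exists x; first by rewrite inE Mx.
rewrite !inE eqxx orbF Bx andbT.
by apply: contraNneq nBy => <-.
Qed.

(** Separating [M] from the empty set already puts [M] inside a maximum stable set. *)
Lemma in_W2_well_covered : in_W2 e -> well_covered e.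
Proof.
move=> [_ sep] M /maxsetP[stM maxM].
have dM0 : [disjoint M & set0] by rewrite -setI_eq0 setI0.
have [M' [_ [maxM' _ _ sMM' _]]] := sep _ _ stM stable0 dM0.
by have [stM' _] := maximum_stableP _ maxM'; rewrite -(maxM _ stM' sMM').
Qed.

Lemma in_W2_family_A_sub : irreflexive e -> in_W2 e -> family_A e \subset family_F e.
Proof.
move=> e_irr [_ sep]; apply/subsetP => A; rewrite !inE => /andP[stA].
rewrite minimal_vertex_coverE; set M := ~: _ => mxM.
have sAM : A \subset M.
  apply/subsetP => x Ax; rewrite inE mem_neighbours negbK.
  by rewrite (setUidPr _) ?sub1set.
suff /eqP-> : A == M by [].
rewrite eqEsubset sAM; apply/subsetP => x Mx; apply/negPn/negP => nAx.
have dAx : [disjoint A & [set x]] by rewrite disjoint_sym disjoints1.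
have [A' [B' [maxA' _ dA'B' sAA' sxB']]] := sep _ _ stA (stable1 x e_irr) dAx.
have [stA' _] := maximum_stableP _ maxA'.
(* [A'] is stable and contains [A], so none of its vertices lies in [neighbours e A]. Maximality
   then gives [A' = M], which puts [x] in both [A'] and [B']. *)
have sA'M : A' \subset M.
  apply/subsetP => y A'y; rewrite inE mem_neighbours negbK.
  by apply: stable_sub stA'; rewrite subUset sub1set A'y.
have [_ /(_ M (maxsetp mxM) sA'M) eqM] := maxsetP (maximum_maximal maxA').
by move: sxB'; rewrite sub1set (disjointFr dA'B') // -eqM.
Qed.

End StableSets.

Theorem theorem4p3 (T : finType) (e : rel T)
    (e_sym : symmetric e) (e_irr : irreflexive e)
    (T_nonempty : 0 < #|T|)
    (no_isolated : forall x : T, exists y : T, e x y) :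
  in_W2 e <-> (well_covered e /\ family_F e = family_A e).
Proof.
split=> [W2 | [wc eqFA]].
  split; first exact: in_W2_well_covered.
  by apply/eqP; rewrite eqEsubset family_F_sub in_W2_family_A_sub.
split=> [|A B stA stB dAB].
  have /card_gt0P[x _] := T_nonempty; have [y exy] := no_isolated x.
  by apply/card_gt1P; exists x, y; split=> //; apply: contraTneq exy => ->; rewrite e_irr.
have [A' [maxA' sAA' dA'B]] := extend_avoiding e e_sym e_irr wc eqFA stA stB dAB.
have [stA' _] := maximum_stableP _ _ maxA'.
rewrite disjoint_sym in dA'B.
(* The second extension avoids all of [A'], not just [A]. *)
have [B' [maxB' sBB' dB'A']] := extend_avoiding e e_sym e_irr wc eqFA stB stA' dA'B.
by exists A', B'; split=> //; rewrite disjoint_sym.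
Qed.
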